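(* Let $p$ be an odd prime, $n\ge 2$ an integer, and $A,k$ integers with $|A|<p/2$, $p\nmid A$, $1\le k<p-1$, $\gcd(k,p-1)=1$. Let $f(x)=Ax^k\bmod p$ (least positive residue) on $I=\{1,\dots,p-1\}$, for $0\le j\le n-1$ let $I_j=\{x:1\le x\le p-1,\ x\equiv j\pmod n\}$, let $d=\gcd(k-1,p-1)$, and let $$\mathscr{C}=\{C\equiv Ax^{k-1}\bmod p:\ 1\le x\le p-1,\ |C|<p/2\}.$$ Suppose $\mathscr{C}$ contains an integer $C$ with $n\le |C|\le p/n$. If $p>10^6$ and $d\ge 0.88\, n^2 p^{1/2}\log^2 p$, or if $k=1$, then $f(I_i)\cap I_j\ne\emptyset$ for all $0\le i,j\le n-1$.
   Context: $\log$ denotes the natural logarithm. *)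

(* Defs.v *)
From HB Require Import structures.
From mathcomp Require Import all_boot all_order all_algebra.
From mathcomp Require Import all_classical all_reals all_analysis.

Set Implicit Arguments.
Unset Strict Implicit.
Unset Printing Implicit Defensive.

Import Order.TTheory GRing.Theory Num.Theory.
Local Open Scope classical_set_scope.
Local Open Scope ring_scope.

(* [modz] returns the representative in {0, ..., p-1}; for p prime with p not
   dividing A and 1 <= x <= p-1 it is nonzero, hence it is also the least
   positive residue. *)
Definition residue_map (p k : nat) (A : int) (x : int) : int :=
  ((A * x ^+ k) %% p%:Z)%Z.

Definition residue_class (p n j : nat) : set int :=
  [set x : int | 1 <= x <= p%:Z - 1 /\ (x = j%:Z %[mod n%:Z])%Z].

Definition coef_set (p k : nat) (A : int) : set int :=
  [set C : int | `|C|%:Q < p%:Q / 2 /\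
     exists x : int, 1 <= x <= p%:Z - 1 /\
       (C = A * x ^+ (k - 1) %[mod p%:Z])%Z].

(* Main.v *)
Require Import Defs.
From HB Require Import structures.
From mathcomp Require Import all_boot all_order all_algebra.
From mathcomp Require Import all_solvable all_field.
From mathcomp Require Import all_classical all_reals all_analysis.
From mathcomp Require Import complex ring lra zify.

(** Write [C] for the given element of the coefficient set, [c = |C|], and [x0]
    for a point with [C = A x0^(k-1)] modulo [p].  On the coset [x0 H], where
    [H] is the group of solutions of [h^(k-1) = 1], the map [f] is multiplication by
    [C].  Since [c x = p floor(c x / p) + (c x mod p)], the two congruences
    modulo [n] say that [x] is in a class modulo [n] and that [floor (c x / p)]
    is in a class modulo [n]; such [x] fill runs of about [p / (c n)] terms of
    an arithmetic progression of step [n], one run for each admissible value of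
    the floor.  For [k = 1] one run suffices.

    Otherwise exponential sums over [H] are at most [sqrt p], so a function on
    the prime field whose Fourier coefficients have l1 norm [B] and whose
    support avoids [x0 H] satisfies [#|H| sum <= p sqrt p B].  The condition on [x] is
    smoothed into a Fejer kernel of l1 norm 1 (after normalisation).  If
    [c <= 31 n], such a kernel inside a single run is enough.  If [c > 31 n],
    the kernel is spread over the whole class of [x] and multiplied by the sharp
    indicator of the class of [c x mod p], whose l1 norm is at most
    [3 + 2 ln p]. *)

Set Implicit Arguments.
Unset Strict Implicit.
Unset Printing Implicit Defensive.

Import Order.TTheory GRing.Theory Num.Theory.
Import numFieldNormedType.Exports.

(** * Two congruences modulo [n] *)

(** A half-open window as long as the step [c * n] catches a term of any progression that starts
    before its right end. *)
Lemma progression_hits c n e m : 0 < c -> 0 < n -> c * e < m + c * n ->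
  exists b, m <= c * (e + n * b) < m + c * n.
Proof.
move=> c0 n0 lt_e; have cn0 : 0 < c * n by rewrite muln_gt0 c0.
have [le_m|lt_m] := leqP m (c * e).
  by exists 0; rewrite muln0 addn0 le_m.
(* The ceiling of [(m - c * e) / (c * n)]. *)
exists ((m - c * e + (c * n).-1) %/ (c * n)); set b := _ %/ _.
have := divn_eq (m - c * e + (c * n).-1) (c * n); rewrite -/b.
have := ltn_pmod (m - c * e + (c * n).-1) cn0.
have -> : c * (e + n * b) = c * e + b * (c * n).
  by rewrite mulnDr mulnA [b * _]mulnC.
set r := _ %% _; set t := b * _; lia.
Qed.

Section TwoCongruences.
Variables p n c i j : nat.
Hypotheses (n_gt0 : 0 < n) (n_le_c : n <= c) (cn_le_p : c * n <= p).
Hypothesis p_coprime_n : coprime p n.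

Local Notation s := (p %/ (c * n)).

Let c_gt0 : 0 < c := leq_trans n_gt0 n_le_c.
Let cn_gt0 : 0 < c * n. Proof. by rewrite muln_gt0 c_gt0. Qed.
Let p_gt0 : 0 < p := leq_trans cn_gt0 cn_le_p.

Lemma quotient_class_exists :
  exists2 m0, m0 < n & m0 * p + j = c * i %[mod n].
Proof.
(* [j * n.-1] stands for [-j] modulo [n]. A multiple of [p] in this class exists because [p] and [n]
   are coprime. *)
pose t := c * i + j * n.-1.
pose x := chinese p n 0 t.
have /dvdnP[m xE] : p %| x by rewrite /dvdn chinese_modl// mod0n.
have xt : x = t %[mod n] by rewrite /x chinese_modr.
exists (m %% n); first exact: ltn_pmod.
rewrite -modnDml modnMml -xE xt modnDml /t -addnA -mulnSr prednK//.
by rewrite addnC modnMDl.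
Qed.

(* If [floor (c x / p) = m], then [c x = m p + (c x mod p)], so the residue of
   [c x mod p] modulo [n] is read off those of [x] and [m]. *)
Lemma residue_of_quotient m0 m x : m0 * p + j = c * i %[mod n] ->
  m = m0 %[mod n] -> x = i %[mod n] -> c * x %/ p = m ->
  c * x %% p = j %[mod n].
Proof.
move=> m0E mE xE mx; apply/eqP; rewrite -(eqn_modDl (m0 * p)) m0E.
rewrite -modnDml -modnMml -mE modnMml modnDml -mx -divn_eq.
by rewrite -modnMmr xE modnMmr.
Qed.

(** The first term puts [c * x] in [[m * p, m * p + c * n)]. Each later one adds [c * n], and
    [s * (c * n) <= p], so [s] terms stay below [m.+1 * p]. *)
Lemma quotient_run m e : c * e < m * p + c * n -> exists b, forall t, t < s ->
  c * (e + n * (b + t)) %/ p = m /\ c * (e + n * (b + t)) < m.+1 * p.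
Proof.
move=> /(progression_hits c_gt0 n_gt0)[b /andP[b1 b2]]; exists b => t ts.
have E : c * (e + n * (b + t)) = c * (e + n * b) + t * (c * n) by nia.
have le_s : t.+1 * (c * n) <= p.
  by apply: leq_trans (leq_trunc_div p (c * n)); rewrite leq_mul2r ts orbT.
have lt_p : c * (e + n * (b + t)) < m.+1 * p by rewrite E; nia.
split=> //; apply/eqP; rewrite eqn_leq -ltnS ltn_divLR// lt_p /=.
by rewrite leq_divRL// E; nia.
Qed.

Lemma progression_in_residues : i < n ->
  exists2 xs, xs = i %[mod n] & forall t, t < s ->
    xs + n * t < p /\ c * (xs + n * t) %% p = j %[mod n].
Proof.
move=> i_n; have [m0 m0n m0E] := quotient_class_exists.
have [|b bP] := @quotient_run m0 i.
  by rewrite ltn_addl// ltn_pmul2l.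
exists (i + n * b); first by rewrite addnC mulnC modnMDl.
move=> t /bP; rewrite (mulnDr n) addnA => -[qE ltp]; split.
  (* [m0 < n <= c] gives [c * x < m0.+1 * p <= c * p]. *)
  rewrite -(ltn_pmul2l c_gt0); apply: leq_trans ltp _.
  by rewrite leq_mul2r (leq_trans m0n) ?orbT.
apply: residue_of_quotient m0E _ _ qE => //.
by rewrite -addnA -mulnDr addnC mulnC modnMDl.
Qed.

(** Over the window [c * x] sweeps a length [c * n * K], and admissible floors recur every [n * p].
    The hypothesis leaves room for [r] of them, each with its run of [s] terms; the floor tells the
    runs apart. *)
Lemma window_count K e r : e = i %[mod n] -> (n * r).+1 * p <= c * n * K ->
  r * s <= #|[set b : 'I_K | c * (e + n * b) %% p == j %[mod n]]|.
Proof.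
move=> eE rK; have [m0 m0n m0E] := quotient_class_exists.
(* [m0 + n * l0] is an admissible floor whose block starts at or after [c * e], by less than
   [n * p]. *)
have [|l0 /andP[l01 l02]] := @progression_hits p n m0 (c * e) p_gt0 n_gt0.
  by rewrite ltn_addl// ltn_pmul2l.
pose m (l : nat) := m0 + n * l0 + n * l.
have cB (l : 'I_r) : exists b, forall t, t < s ->
    c * (e + n * (b + t)) %/ p = m l /\ c * (e + n * (b + t)) < (m l).+1 * p.
  by apply: quotient_run; rewrite /m; nia.
have {cB}[B BP] := fin_all_exists cB.
have ltK (l : 'I_r) (t : 'I_s) : B l + t < K.
  have [_ lt1] := BP l t (ltn_ord t).
  have le1 : (m l).+1 * p <= c * e + (n * r).+1 * p.
    have lr := ltn_ord l.
    have : n * l + n <= n * r by rewrite -mulnSr leq_mul2l lr orbT.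
    move=> nl; rewrite /m.
    have -> : (m0 + n * l0 + n * l).+1 * p = p * (m0 + n * l0) + (n * l).+1 * p.
      by rewrite -addnS mulnDl [X in X + _]mulnC.
    have : (n * l).+1 * p + p * n <= (n * r).+1 * p.
      by rewrite [p * n]mulnC -mulnDl leq_mul2r addSn ltnS nl orbT.
    lia.
  have : c * (e + n * (B l + t)) < c * e + c * n * K.
    by apply: leq_trans lt1 (leq_trans le1 _); rewrite leq_add2l.
  by rewrite mulnDr ltn_add2l mulnA ltn_pmul2l.
pose f (lt : 'I_r * 'I_s) := Ordinal (ltK lt.1 lt.2).
have inj_f : injective f.
  move=> [l t] [l' t'] /(congr1 val) /= E.
  have [q1 _] := BP l t (ltn_ord t); have [q2 _] := BP l' t' (ltn_ord t').
  have : m l = m l' by rewrite -q1 -q2 E.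
  move=> /eqP; rewrite /m eqn_add2l eqn_pmul2l// => /eqP /val_inj ll'.
  by move: E; rewrite ll' => /addnI /val_inj ->.
rewrite -[r in r * _]card_ord -[s in _ * s]card_ord -card_prod.
rewrite -(card_codom inj_f); apply: subset_leq_card.
apply/fintype.subsetP => _ /codomP[[l t] ->]; rewrite inE /=.
have [qE _] := BP l t (ltn_ord t).
apply/eqP; apply: residue_of_quotient m0E _ _ qE.
  by rewrite /m -addnA -mulnDr addnC mulnC modnMDl.
by rewrite addnC mulnC modnMDl.
Qed.

End TwoCongruences.

Local Open Scope ring_scope.

(** * Fourier analysis on a finite field *)

Section FiniteFourier.
Variables (F : numClosedFieldType) (T : finFieldType) (e : T -> F).
Hypothesis eD : {morph e : u v / u + v >-> u * v}.
Hypothesis e_norm : forall u, `|e u| = 1.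
Hypothesis e_nontrivial : exists u, e u != 1.

Local Notation q := (#|T|%:R : F).

Lemma char_neq0 u : e u != 0.
Proof. by rewrite -normr_gt0 e_norm. Qed.

Lemma char0 : e 0 = 1.
Proof. by apply: (mulfI (char_neq0 0)); rewrite mulr1 -eD addr0. Qed.

Lemma charN u : e (- u) = (e u)^*.
Proof.
apply: (mulfI (char_neq0 u)).
by rewrite -eD subrr char0 -normCK e_norm expr1n.
Qed.

Lemma card_neq0 : q != 0.
Proof. by rewrite pnatr_eq0 -lt0n; apply/card_gt0P; exists 0. Qed.

Lemma sum_char x : \sum_u e (u * x) = if x == 0 then q else 0.
Proof.
case: eqVneq => [->|x0].
  by rewrite (eq_bigr (fun=> 1)) ?sumr_const// => u _; rewrite mulr0 char0.
have [u eu] := e_nontrivial.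
have inj : injective (fun v : T => v + u / x) by exact: addIr.
have : \sum_v e (v * x) = e u * \sum_v e (v * x).
  rewrite [LHS](reindex_inj inj) /= mulr_sumr; apply: eq_bigr => v _.
  by rewrite mulrDl divfK// eD mulrC.
move/eqP; rewrite -subr_eq0 -[X in X - _]mul1r -mulrBl mulf_eq0 subr_eq0.
by rewrite eq_sym (negPf eu) => /eqP.
Qed.

(** * Gaussian periods and sums over cosets *)

Section Periods.
Variable H : {set T}.
Hypothesis H_neq0 : forall h, h \in H -> h != 0.
Hypothesis H_mul : forall g h, g \in H -> h \in H -> g * h \in H.

(** Gaussian period: the Fourier transform of the indicator of [H]. *)
Definition period w := \sum_(h in H) e (w * h).

Lemma period_mull w g : g \in H -> period (w * g) = period w.
Proof.
move=> gH; have inj : injective ( *%R g) by apply: mulfI; apply: H_neq0.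
have HE : [set g * h | h in H] = H.
  apply/eqP; rewrite eqEcard card_imset// leqnn andbT.
  by apply/fintype.subsetP => _ /imsetP[h hH ->]; apply: H_mul.
rewrite /period -[in RHS]HE big_imset /=; last by move=> x y _ _ /inj.
by apply: eq_bigr => h _; rewrite mulrA.
Qed.

Lemma period_parseval : \sum_w `|period w| ^+ 2 = q * #|H|%:R.
Proof.
transitivity (\sum_w \sum_(h in H) \sum_(g in H) e (w * (h - g))).
  apply: eq_bigr => w _; rewrite normCK /period rmorph_sum big_distrlr /=.
  apply: eq_bigr => h _; apply: eq_bigr => g _.
  by rewrite -charN -eD mulrBr.
rewrite exchange_big /= mulr_natr -sumr_const; apply: eq_bigr => h hH.
rewrite exchange_big /= (bigD1 h) //= subrr sum_char eqxx big1 ?addr0// => g.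
by case/andP => _ gh; rewrite sum_char subr_eq0 eq_sym (negPf gh).
Qed.

(* [period] is constant on the #|H| points of [w * H], so Parseval bounds each
   value: no Gauss sums are needed. *)
Lemma period_le w : w != 0 -> `|period w| <= sqrtC q.
Proof.
move=> w0; rewrite -(@ler_pXn2r _ 2%N)// ?nnegrE ?sqrtC_ge0 ?ler0n// sqrtCK.
have [/cards0_eq H0|H_gt0] := posnP #|H|.
  by rewrite /period H0 big_set0 normr0 expr0n ler0n.
have Hgt0 : 0 < #|H|%:R :> F by rewrite ltr0n.
rewrite -(ler_pM2r Hgt0) -period_parseval mulr_natr -sumr_const.
rewrite (eq_bigr (fun h => `|period (w * h)| ^+ 2)); last first.
  by move=> h hH; rewrite period_mull.
rewrite -(@big_imset _ _ _ _ _ ( *%R w) (mem H) (fun u => `|period u| ^+ 2));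
  last by move=> x y _ _ /(mulfI w0).
rewrite [leRHS](bigID (mem [set w * h | h in H])) /= lerDl.
by apply: sumr_ge0 => u _; rewrite exprn_ge0.
Qed.

(** Subtracting the mean kills frequency 0 and changes no other frequency, so the bound of
    [period_le] now holds for every [w]. *)
Lemma balanced_period_le w :
  `|\sum_x ((x \in H)%:R - #|H|%:R / q) * e (w * x)| <= sqrtC q.
Proof.
have -> : \sum_x ((x \in H)%:R - #|H|%:R / q) * e (w * x)
          = period w - (if w == 0 then #|H|%:R else 0).
  under eq_bigr do rewrite mulrBl.
  rewrite sumrB -mulr_sumr; congr (_ - _).
    rewrite /period [RHS]big_mkcond /=; apply: eq_bigr => x _.
    by case: ifP; rewrite ?mul1r ?mul0r.
  under eq_bigr do rewrite mulrC; rewrite sum_char.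
  by case: ifP; rewrite ?mulr0// divfK// card_neq0.
case: eqVneq => [->|w0]; last by rewrite subr0 period_le.
rewrite /period (eq_bigr (fun=> 1)); last by move=> h _; rewrite mul0r char0.
by rewrite sumr_const subrr normr0 sqrtC_ge0 ler0n.
Qed.

(** Expanding both weights, the pair of frequencies [u], [v] contributes a balanced period at
    [(u + v * c) * x0], bounded uniformly. Only the l1 norms of the coefficients remain. *)
Lemma coset_sum_le (a1 a2 w1 w2 : T -> F) (x0 c : T) : x0 != 0 ->
  (forall x, w1 x = \sum_u a1 u * e (u * x)) ->
  (forall x, w2 x = \sum_u a2 u * e (u * x)) ->
  `|\sum_(h in H) w1 (x0 * h) * w2 (c * (x0 * h))
     - #|H|%:R / q * \sum_x w1 x * w2 (c * x)|
    <= sqrtC q * (\sum_u `|a1 u|) * (\sum_u `|a2 u|).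
Proof.
move=> x0n w1E w2E.
rewrite [X in _ * X](reindex_inj (mulfI x0n)) /= mulr_sumr.
rewrite [X in `|X - _|]big_mkcond /= -sumrB.
rewrite (eq_bigr (fun x => \sum_u \sum_v (a1 u * a2 v) *
   (((x \in H)%:R - #|H|%:R / q) * e ((u + v * c) * x0 * x)))); last first.
  move=> x _; transitivity (((x \in H)%:R - #|H|%:R / q) *
      (w1 (x0 * x) * w2 (c * (x0 * x)))).
    by rewrite mulrBl; case: ifP; rewrite ?mul1r ?mul0r.
  rewrite w1E w2E big_distrlr /= mulr_sumr; apply: eq_bigr => u _.
  rewrite mulr_sumr; apply: eq_bigr => v _.
  rewrite mulrACA -eD mulrCA; congr (_ * (_ * e _)).
  by rewrite !mulrDl !mulrA.
rewrite exchange_big /= -mulrA mulr_suml mulr_sumr.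
apply: le_trans (ler_norm_sum _ _ _) _; apply: ler_sum => u _.
rewrite exchange_big /= mulr_sumr mulr_sumr.
apply: le_trans (ler_norm_sum _ _ _) _; apply: ler_sum => v _.
rewrite -mulr_sumr !normrM mulrC ler_wpM2r ?mulr_ge0//.
exact: balanced_period_le.
Qed.

End Periods.

(** Fourier coefficient of the function counting the [i] with [y i = x]. *)
Definition count_coef (I : finType) (y : I -> T) (u : T) : F :=
  q^-1 * \sum_i e (- (u * y i)).

Lemma count_coefE (I : finType) (y : I -> T) x :
  \sum_i (x == y i)%:R = \sum_u count_coef y u * e (u * x).
Proof.
under [RHS]eq_bigr do rewrite /count_coef -mulrA mulr_suml.
rewrite -mulr_sumr exchange_big mulr_sumr /=; apply: eq_bigr => i _.
under eq_bigr do rewrite -eD -mulrN -mulrDr.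
rewrite sum_char addrC subr_eq0; case: eqP => _; last by rewrite mulr0.
by rewrite mulVf// card_neq0.
Qed.

(* Fejer kernel: the coefficients of the sumset count are, up to a phase,
   squares, so Parseval evaluates their l1 norm exactly. *)
Lemma fejer_coef_sum (K : nat) (z : 'I_K -> T) (y0 : T) : injective z ->
  \sum_u `|count_coef (fun ab : 'I_K * 'I_K => y0 + (z ab.1 + z ab.2)) u|
    = K%:R.
Proof.
move=> inj_z.
have E u : `|count_coef (fun ab : 'I_K * 'I_K => y0 + (z ab.1 + z ab.2)) u|
    = q^-1 * \sum_a \sum_b e (u * (z b - z a)).
  rewrite /count_coef normrM ger0_norm ?invr_ge0 ?ler0n//; congr (_ * _).
  transitivity (`|\sum_a e (- (u * z a))| ^+ 2).
    transitivity `|e (- (u * y0)) * (\sum_a e (- (u * z a))) ^+ 2|.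
      congr `|_|; rewrite expr2 big_distrlr /= pair_big /= mulr_sumr.
      by apply: eq_bigr => -[a b] _ /=; rewrite -!eD -!opprD -!mulrDr.
    by rewrite normrM e_norm mul1r normrX.
  rewrite normCK rmorph_sum big_distrlr /=; apply: eq_bigr => a _.
  by apply: eq_bigr => b _; rewrite -charN opprK -eD addrC mulrBr.
under eq_bigr do rewrite E.
rewrite -mulr_sumr exchange_big /=.
rewrite (eq_bigr (fun=> q)).
  by rewrite sumr_const card_ord -[q *+ K]mulr_natr mulKf// card_neq0.
move=> a _; rewrite exchange_big /= (bigD1 a)//= subrr sum_char eqxx.
rewrite big1 ?addr0// => b ba; rewrite sum_char subr_eq0 (inj_eq inj_z).
by rewrite (negPf ba).
Qed.

(** [coset_sum_le] with the Fejer kernel, of l1 norm [K], as first weight: the coset sum vanishes,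
    so the mean term alone is within the error. *)
Lemma coset_avoiding_le (H : {set T}) (K : nat) (z : 'I_K -> T) (y0 x0 c : T)
    (a w : T -> F) :
  (forall h, h \in H -> h != 0) ->
  (forall g h, g \in H -> h \in H -> g * h \in H) ->
  x0 != 0 -> injective z -> (forall x, w x = \sum_u a u * e (u * x)) ->
  (forall h k l, h \in H -> x0 * h = y0 + (z k + z l) ->
     w (c * (x0 * h)) = 0) ->
  #|H|%:R * `|\sum_k \sum_l w (c * (y0 + (z k + z l)))|
    <= q * (sqrtC q * K%:R * \sum_u `|a u|).
Proof.
move=> H0 HM x0n inj_z wE avoid.
pose y (kl : 'I_K * 'I_K) := y0 + (z kl.1 + z kl.2).
have := @coset_sum_le H H0 HM _ a (fun x => \sum_i (x == y i)%:R) w x0 c x0n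
  (count_coefE y) wE.
rewrite fejer_coef_sum// [X in `|X - _|]big1 => [|h hH]; last first.
  rewrite mulr_suml big1// => -[k l] _.
  case: eqP => [E|_]; last by rewrite mul0r.
  by rewrite (avoid h k l) ?mulr0.
rewrite sub0r normrN normrM ger0_norm ?mulr_ge0 ?invr_ge0 ?ler0n//.
have -> : \sum_x (\sum_i (x == y i)%:R) * w (c * x)
    = \sum_k \sum_l w (c * (y0 + (z k + z l))).
  under eq_bigr do rewrite mulr_suml.
  rewrite exchange_big [RHS]pair_big /=; apply: eq_bigr => -[k l] _.
  rewrite (bigD1 (y (k, l)))//= eqxx mul1r big1 ?addr0// => x /negPf ->.
  by rewrite mul0r.
rewrite mulrAC ler_pdivrMr; last by rewrite lt_def card_neq0 ler0n.
by rewrite [X in _ <= X]mulrC.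
Qed.

Lemma geometric_char_le (Z : nat) (s : T) : e s != 1 ->
  `|\sum_(z < Z) e (s *+ z)| <= 2 / `|1 - e s|.
Proof.
move=> es; have es0 : 0 < `|1 - e s| by rewrite normr_gt0 subr_eq0 eq_sym.
have eX z : e (s *+ z) = e s ^+ z.
  elim: z => [|z IH]; first by rewrite mulr0n expr0 char0.
  by rewrite mulrS eD IH exprS.
rewrite ler_pdivlMr// mulrC -normrM.
under eq_bigr do rewrite eX.
have -> : (1 - e s) * (\sum_(z < Z) e s ^+ z) = 1 - e s ^+ Z.
  by rewrite -[RHS]opprB subrX1 -mulNr opprB.
apply: le_trans (ler_normB _ _) _.
by rewrite normr1 normrX e_norm expr1n.
Qed.

(** Frequency 0 contributes [Z / q <= 1]; the others are geometric sums, and the substitution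
    [u -> - (u * s)] removes the step [s]. *)
Lemma progression_coef_sum (Z : nat) (y0 s : T) : s != 0 -> (Z <= #|T|)%N ->
  (forall u, u != 0 -> e u != 1) ->
  \sum_u `|count_coef (fun z : 'I_Z => y0 + s *+ z) u|
    <= 1 + \sum_(u | u != 0) 2 / q / `|1 - e u|.
Proof.
move=> s0 leZ e1; rewrite (bigD1 0)//=; apply: lerD.
  rewrite /count_coef; under eq_bigr do rewrite mul0r oppr0 char0.
  rewrite sumr_const card_ord ger0_norm ?mulr_ge0 ?invr_ge0 ?ler0n//.
  by rewrite mulrC ler_pdivrMr ?mul1r ?ler_nat// lt_def card_neq0 ler0n.
have inj : injective (fun u : T => - (u * s)).
  by move=> u v /oppr_inj/(mulIf s0).
rewrite [leRHS](reindex_inj inj) /=.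
rewrite [leRHS](eq_bigl (fun u => u != 0)); last first.
  by move=> u; rewrite oppr_eq0 mulf_eq0 (negPf s0) orbF.
apply: ler_sum => u u0; rewrite /count_coef normrM.
rewrite ger0_norm ?invr_ge0 ?ler0n// mulrAC mulrC.
rewrite ler_wpM2r ?invr_ge0 ?ler0n//.
have -> : \sum_(i < Z) e (- (u * (y0 + s *+ i)))
    = e (- (u * y0)) * \sum_(i < Z) e (- (u * s) *+ i).
  rewrite mulr_sumr; apply: eq_bigr => i _.
  by rewrite -eD mulrDr opprD mulrnAr mulNrn.
rewrite normrM e_norm mul1r; apply: geometric_char_le; apply: e1.
by rewrite oppr_eq0 mulf_neq0.
Qed.

End FiniteFourier.

(** * Real and trigonometric estimates *)

Section RealEstimates.
Variable R : realType.

Lemma sin_ge_xcos (x : R) : 0 <= x <= pi -> x * cos x <= sin x.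
Proof.
move=> /andP[]; rewrite le_eqVlt => /predU1P[<-|x0] xpi.
  by rewrite mul0r sin0.
have [|y] := @MVT R sin cos 0 x x0 (fun y _ => is_derive_sin y).
  by apply: continuous_subspaceT => z; exact: continuous_sin.
rewrite in_itv /= => /andP[y0 yx].
rewrite sin0 !subr0 => ->; rewrite mulrC ler_wpM2r ?(ltW x0)//.
rewrite leNgt; apply/negP.
rewrite ltr_cos ?in_itv /= ?(ltW x0) ?(ltW y0) ?(le_trans (ltW yx))//.
by rewrite ltNge (ltW yx).
Qed.

(** Half-angle: [sin x = 2 cos(x/2) sin(x/2) >= x cos(x/2)^2], and [cos(x/2)^2 >= 1/2] because
    [cos x >= 0]. *)
Lemma sin_ge_half (x : R) : 0 <= x <= pi / 2 -> x / 2 <= sin x.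
Proof.
move=> /andP[x0 xpi].
have := @pi_ge2 R => pi2.
have c0 : 0 <= cos x by apply: cos_ge0_pihalf; apply/andP; split; lra.
have h1 : x / 2 * cos (x / 2) <= sin (x / 2).
  by apply: sin_ge_xcos; apply/andP; split; lra.
have c1 : 0 <= cos (x / 2) by apply: cos_ge0_pihalf; apply/andP; split; lra.
have E : (x / 2) *+ 2 = x by rewrite -mulr_natr divfK.
have sE : sin x = 2 * (cos (x / 2) * sin (x / 2)).
  by rewrite -{1}E sin_mulr2n mulr_natl.
have cE : cos x = 2 * cos (x / 2) ^+ 2 - 1.
  by rewrite -{1}E cos_mulr2n mulr_natl.
nra.
Qed.

Lemma expR1_le3 : expR 1 <= 3 :> R.
Proof.
(* Invert [exp(-1/6) >= 5/6]; the sixth power of [6/5] is about 2.986. *)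
have h : expR (6^-1) <= 6 / 5 :> R.
  have := expR_ge1Dx (- 6^-1 : R); rewrite expRN => h.
  rewrite -[leLHS]invrK invf_ple ?posrE ?invr_gt0 ?expR_gt0//.
  by apply: le_trans h; lra.
have -> : (1 : R) = 6^-1 * 6 by rewrite mulVf.
rewrite expRM_natr.
apply: le_trans (_ : (6 / 5) ^+ 6 <= _); last by lra.
by rewrite lerXn2r// nnegrE ?expR_ge0//; lra.
Qed.

Lemma ln_ge12 (x : R) : 10 ^+ 6 < x -> 12 <= ln x.
Proof.
move=> hx; have x0 : 0 < x by apply: lt_trans hx; lra.
rewrite -ler_expR lnK ?posrE//; apply: le_trans (ltW hx).
rewrite -[12]mulr1 expRM_natl.
(* [3^12 = 531441 < 10^6]. *)
apply: le_trans (_ : 3 ^+ 12 <= _); last by lra.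
by rewrite lerXn2r// ?nnegrE ?expR_ge0// expR1_le3.
Qed.

Lemma harmonic_le_ln (n : nat) : (0 < n)%N ->
  \sum_(1 <= v < n.+1) (v%:R)^-1 <= 1 + ln n%:R :> R.
Proof.
elim: n => // -[|n] IH _; first by rewrite big_nat1 ln1 invr1 addr0.
rewrite big_nat_recr//=; apply: le_trans (lerD (IH _) (lexx _)) _ => //.
rewrite -addrA lerD2l -lerBrDl.
have n0 : 0 < n.+1%:R :> R by rewrite ltr0n.
have n1 : 0 < n.+2%:R :> R by rewrite ltr0n.
(* With [N = n + 2], the increment is [1 / N <= - ln (1 - 1 / N)]. *)
rewrite -ln_div ?posrE// -[ln _]opprK -lnV ?posrE ?divr_gt0// invf_div.
rewrite lerNr.
have -> : n.+1%:R / n.+2%:R = 1 + (- n.+2%:R^-1) :> R.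
  apply: (mulIf (lt0r_neq0 n1)); rewrite divfK ?lt0r_neq0// mulrDl mulNr.
  by rewrite mulVf ?lt0r_neq0// mul1r -[n.+2%:R]natr1 addrK.
by apply: le_ln1Dx; rewrite ltrN2 invf_lt1// ltr1n.
Qed.

End RealEstimates.

(** * Points of the unit circle *)

Section Roots.
Variable R : realType.
Local Open Scope complex_scope.

Definition expi (x : R) : R[i] := cos x +i* sin x.

Lemma expi0 : expi 0 = 1.
Proof. by rewrite /expi cos0 sin0. Qed.

Lemma expiD x y : expi (x + y) = expi x * expi y.
Proof. by rewrite /expi cosD sinD; simpc; congr (_ +i* _); rewrite addrC. Qed.

Lemma expiX x n : expi x ^+ n = expi (x *+ n).
Proof.
elim: n => [|n IH]; first by rewrite mulr0n expi0.
by rewrite exprS IH -expiD mulrS.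
Qed.

Lemma norm_expi x : `|expi x| = 1.
Proof. by rewrite normc_def /= cos2Dsin2 sqrtr1. Qed.

Lemma norm_1Bexpi x : `|1 - expi (x *+ 2)| = (2 * `|sin x|)%:C.
Proof.
rewrite normc_def /= cos_mulr2n sin_mulr2n; congr _%:C.
have -> : (1 - (cos x ^+ 2 *+ 2 - 1)) ^+ 2 + (0 - cos x * sin x *+ 2) ^+ 2 =
   (2 * sin x) ^+ 2.
  have := cos2Dsin2 x; nra.
by rewrite sqrtr_sqr normrM ger0_norm.
Qed.

End Roots.

(** * Cosets in the prime field *)

Section PrimeField.
Variables (R : realType) (p : nat).
Hypothesis p_prime : prime p.
Local Open Scope complex_scope.

Let p_gt0 : (0 < p)%N := prime_gt0 p_prime.
Let pR_gt0 : 0 < p%:R :> R. Proof. by rewrite ltr0n. Qed.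

(** The additive character [exp(2 pi i u / p)], written as a power so that additivity is reduction
    of exponents modulo [p]. *)
Definition fpchar (u : 'F_p) : R[i] := expi (pi *+ 2 / p%:R) ^+ u.

Lemma ltn_Fp (u : 'F_p) : (u < p)%N.
Proof. by rewrite -[X in (_ < X)%N](Fp_cast p_prime); exact: ltn_ord. Qed.

Lemma natFp_neq0 x : (0 < x < p)%N -> (x%:R : 'F_p) != 0.
Proof.
by case/andP=> x0 xp; rewrite -(dvdn_pcharf (pchar_Fp p_prime)) gtnNdvd.
Qed.

Lemma fpcharD : {morph fpchar : u v / u + v >-> u * v}.
Proof.
move=> u v; rewrite /fpchar -exprD -[RHS](@expr_mod _ p).
  by rewrite /= [X in (_ %% X)%N](Fp_cast p_prime).
rewrite expiX -[X in expi X]mulr_natr divfK ?lt0r_neq0//.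
by rewrite /expi cos2pi sin2pi.
Qed.

Lemma norm_fpchar u : `|fpchar u| = 1.
Proof. by rewrite normrX norm_expi expr1n. Qed.

(** The distance is [2 sin (pi u / p)], and this sine is at least [min(u, p - u) / p]. Adding both
    reciprocals avoids the minimum when summing over [u]. *)
Lemma fpchar_dist (u : 'F_p) : u != 0 ->
  fpchar u != 1 /\
  `|1 - fpchar u|^-1 <= (p%:R / 2 * (u%:R^-1 + (p - u)%:R^-1))%:C.
Proof.
move=> u0; have lt_u := ltn_Fp u; have gt_u : (0 < u)%N by rewrite lt0n.
have uR : 0 < u%:R :> R by rewrite ltr0n.
have puR : 0 < (p - u)%:R :> R by rewrite ltr0n subn_gt0.
have pE : p%:R = u%:R + (p - u)%:R :> R by rewrite -natrD subnKC// ltnW.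
have pi2 := @pi_ge2 R; have pi0 := @pi_gt0 R.
pose x : R := pi * u%:R / p%:R.
have ex : fpchar u = expi (x *+ 2).
  rewrite /fpchar expiX /x; congr expi.
  by rewrite -[LHS]mulr_natr; ring.
have xE : x * p%:R = pi * u%:R by rewrite /x divfK ?lt0r_neq0.
have x0 : 0 < x by rewrite /x divr_gt0// mulr_gt0.
have xpi : x < pi by rewrite /x ltr_pdivrMr// ltr_pM2l// ltr_nat.
have sin0 : 0 < sin x by apply: sin_gt0_pi; rewrite x0.
have bnd : (u%:R <= sin x * p%:R) || ((p - u)%:R <= sin x * p%:R).
  have [xh|xh] := leP x (pi / 2).
    have := @sin_ge_half R x; rewrite (ltW x0) xh => /(_ isT) h.
    by apply/orP; left; nra.
  have := @sin_ge_half R (pi - x).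
  have -> : sin (pi - x) = sin x by rewrite sinB sinpi cospi; lra.
  have -> : 0 <= pi - x <= pi / 2 by apply/andP; split; lra.
  move=> /(_ isT) h; apply/orP; right.
  have : (pi - x) * p%:R = pi * (p - u)%:R by rewrite mulrBl xE pE; ring.
  by nra.
have nE : `|1 - fpchar u| = (2 * sin x)%:C.
  by rewrite ex norm_1Bexpi gtr0_norm.
split.
  rewrite eq_sym -subr_eq0 -normr_gt0 nE ltcR; lra.
rewrite nE -fmorphV lecR invfM [p%:R / 2]mulrC -mulrA ler_wpM2l//.
have ui : 0 < u%:R^-1 :> R by rewrite invr_gt0.
have pui : 0 < (p - u)%:R^-1 :> R by rewrite invr_gt0.
have aux (t : R) : 0 < t -> t <= sin x * p%:R -> (sin x)^-1 <= p%:R * t^-1.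
  by move=> t0 ht; rewrite ler_pdivlMr// mulrC ler_pdivrMr// mulrC.
rewrite mulrDr; case/orP: bnd => /aux h.
  by apply: le_trans (h uR) _; rewrite lerDl mulr_ge0 ?ltW.
by apply: le_trans (h puR) _; rewrite lerDr mulr_ge0 ?ltW.
Qed.

Lemma fpchar_nontrivial : exists u, fpchar u != 1.
Proof. by exists 1; have [] := @fpchar_dist 1 (oner_neq0 _). Qed.

(** The bound of [fpchar_dist] gives two harmonic sums, exchanged by [v -> p - v], each at most
    [1 + ln p]. *)
Lemma fpchar_dist_sum :
  \sum_(u : 'F_p | u != 0) 2 / p%:R / `|1 - fpchar u|
    <= (2 + 2 * ln p%:R)%:C.
Proof.
pose f (v : nat) : R := v%:R^-1 + (p - v)%:R^-1.
apply: (@le_trans _ _ (\sum_(u : 'F_p | u != 0) (f u)%:C)).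
  apply: ler_sum => u /fpchar_dist[_ h].
  apply: le_trans (ler_wpM2l _ h) _; first by rewrite divr_ge0 ?ler0n.
  rewrite -[2 / p%:R](_ : (2 / p%:R)%:C = _).
    rewrite -rmorphM lecR mulrA (_ : 2 / p%:R * (p%:R / 2) = 1) ?mul1r//.
    by rewrite mulrA divfK ?lt0r_neq0// divff.
  by rewrite rmorphM fmorphV !rmorph_nat.
rewrite -rmorph_sum lecR.
have -> : \sum_(u : 'F_p | u != 0) f u = \sum_(1 <= v < p) f v.
  transitivity (\sum_(0 <= v < (Zp_trunc (pdiv p)).+2 | v != 0%N) f v).
    by rewrite big_mkord; apply: eq_bigl => u.
  rewrite Fp_cast// big_ltn_cond//= big_nat_cond [RHS]big_nat_cond.
  by apply: eq_bigl => -[|v] //=; rewrite !andbT.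
rewrite big_split /=.
have -> : \sum_(1 <= v < p) ((p - v)%:R : R)^-1 = \sum_(1 <= v < p) v%:R^-1.
  rewrite big_nat_rev /= [LHS]big_nat_cond [RHS]big_nat_cond.
  by apply: eq_bigr => v /andP[/andP[v1 vp] _]; congr (_%:R^-1); lia.
have := @harmonic_le_ln R p p_gt0; rewrite big_nat_recr//= => h.
have : 0 <= p%:R^-1 :> R by rewrite invr_ge0 ltW.
by move: h; set s := \sum_(1 <= v < p) _ => h ?; lra.
Qed.

Section Cosets.
Variables (H : {set 'F_p}) (x0 : 'F_p).
Hypothesis H_neq0 : forall h, h \in H -> h != 0.
Hypothesis H_mul : forall g h, g \in H -> h \in H -> g * h \in H.
Hypothesis x0_neq0 : x0 != 0.

(** [coset_avoiding_le] for the natural points [y0 + n * (k + l)]: the [n * k] are distinct in the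
    field since [K <= p] and [n] is invertible. *)
Lemma coset_avoiding_real (K n y0 c : nat) (w : 'F_p -> nat) (a : 'F_p -> R[i])
    (B : R) :
  (0 < n < p)%N -> (K <= p)%N ->
  (forall x, (w x)%:R = \sum_u a u * fpchar (u * x)) ->
  \sum_u `|a u| <= B%:C ->
  (forall h (k l : 'I_K), h \in H -> x0 * h = (y0 + n * (k + l))%:R ->
     w (c%:R * (x0 * h)) = 0%N) ->
  #|H|%:R * (\sum_(k < K) \sum_(l < K) w (c * (y0 + n * (k + l)))%:R)%:R
    <= p%:R * (Num.sqrt p%:R * K%:R * B).
Proof.
move=> hn Kp wE aB avoid.
have card_p : #|'F_p| = p by rewrite card_Fp.
have nF := natFp_neq0 hn.
pose z (k : 'I_K) : 'F_p := (n * k)%:R.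
have inj_z : injective z.
  move=> k l /eqP; rewrite /z !natrM (inj_eq (mulfI nF)) => /eqP.
  move=> /(congr1 (@nat_of_ord _)); rewrite !val_Fp_nat//.
  rewrite !modn_small ?(leq_trans (ltn_ord _))//; exact: val_inj.
have := @coset_avoiding_le _ _ _ fpcharD norm_fpchar fpchar_nontrivial H K z y0%:R x0 c%:R
  a (fun x => (w x)%:R) H_neq0 H_mul x0_neq0 inj_z wE.
have zE (k l : nat) : (y0%:R + ((n * k)%:R + (n * l)%:R) : 'F_p)
   = (y0 + n * (k + l))%:R by rewrite mulnDr !natrD.
have avoidz h k l : h \in H -> x0 * h = y0%:R + (z k + z l) ->
    (w (c%:R * (x0 * h)))%:R = 0 :> R[i].
  by move=> hH; rewrite /z zE => /avoid ->.
move=> /(_ avoidz); rewrite /z card_p.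
under eq_bigr do under eq_bigr do rewrite zE -natrM.
under eq_bigr do rewrite -natr_sum.
rewrite -natr_sum ger0_norm ?ler0n// => h; rewrite -natrM in h.
rewrite -natrM -lecR rmorph_nat; apply: le_trans h _.
have -> : sqrtC (p%:R : R[i]) = (Num.sqrt p%:R)%:C.
  have -> : (p%:R : R[i]) = (Num.sqrt p%:R)%:C ^+ 2.
    by rewrite -rmorphXn sqr_sqrtr ?ler0n// rmorph_nat.
  by rewrite sqrCK// lecR sqrtr_ge0.
rewrite !rmorphM /= !rmorph_nat ler_wpM2l ?ler0n//.
by rewrite ler_wpM2l// mulr_ge0 ?ler0n// lecR sqrtr_ge0.
Qed.

(** Contrapositive of [coset_avoiding_real] for the constant weight 1, whose only coefficient is 1
    at frequency 0. *)
Lemma coset_meets_progression (K n y0 : nat) :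
  (0 < n < p)%N -> (K <= p)%N ->
  p%:R * Num.sqrt p%:R < #|H|%:R * K%:R :> R ->
  exists h (k l : 'I_K), h \in H /\ x0 * h = (y0 + n * (k + l))%:R.
Proof.
move=> hn Kp; apply: contra_ltP => none.
have avoid h (k l : 'I_K) :
    h \in H -> x0 * h = (y0 + n * (k + l))%:R -> 1%N = 0%N.
  by move=> hH E; case: none; exists h, k, l.
have [->|K0] := posnP K; first by rewrite mulr0 mulr_ge0 ?ler0n ?sqrtr_ge0.
have coefE x : 1%:R = \sum_u (u == 0)%:R * fpchar (u * x).
  rewrite (bigD1 0)//= ?eqxx mul0r mul1r /fpchar expr0 big1 ?addr0//.
  by move=> u /negPf ->; rewrite mul0r.
have coef1 : \sum_(u : 'F_p) `|(u == 0)%:R| <= 1%:C :> R[i].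
  rewrite (bigD1 0)//= ?eqxx normr1 big1 ?addr0// => u /negPf ->.
  by rewrite normr0.
have := @coset_avoiding_real K n y0 0 (fun=> 1%N) _ 1 hn Kp coefE coef1 avoid.
rewrite !sum_nat_const !card_ord muln1 natrM mulr1 !mulrA.
by rewrite ler_pM2r// ltr0n.
Qed.

(** The class of [j] below [p] is the progression [j + n * z] up to [p - 1]; in this form its l1
    norm comes from [progression_coef_sum]. *)
Lemma residue_indicator (n j : nat) (y : 'F_p) : (j < n)%N -> (n < p)%N ->
  (y == j %[mod n])%:R
    = \sum_(z < ((p - j).-1 %/ n).+1) (y == j%:R + n%:R *+ z)%:R :> R[i].
Proof.
move=> jn np; have n0 : (0 < n)%N by exact: leq_ltn_trans jn.
have yE (z : 'I_((p - j).-1 %/ n).+1) :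
    (y == j%:R + n%:R *+ z) = (nat_of_ord y == (j + n * z)%N).
  have ltp : (j + n * z < p)%N.
    have := leq_trunc_div (p - j).-1 n.
    have := ltn_ord z; rewrite ltnS => zle.
    have : (z * n <= (p - j).-1 %/ n * n)%N by rewrite leq_mul2r zle orbT.
    by rewrite mulnC; move: (_ %/ _ * _)%N => t; lia.
  rewrite -mulrnA -natrD; apply/eqP/eqP => [->|yz].
    by rewrite val_Fp_nat// modn_small.
  by rewrite -yz natr_Zp.
have [/eqP yj|ny] := boolP (y == j %[mod n]).
  have yq : nat_of_ord y = (j + n * (y %/ n))%N.
    by rewrite {1}(divn_eq y n) yj (modn_small jn) addnC mulnC.
  have lt_q : (y %/ n < ((p - j).-1 %/ n).+1)%N.
    rewrite ltnS leq_divRL// mulnC; have := ltn_Fp y; rewrite {1}yq.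
    by move: (n * _)%N => t; lia.
  rewrite (bigD1 (Ordinal lt_q))// yE /= -yq eqxx big1 ?addr0// => z.
  rewrite yE; apply: contraNeq; rewrite pnatr_eq0 eqb0 negbK {1}yq.
  by rewrite eqn_add2l eqn_pmul2l// eq_sym.
rewrite big1// => z _; rewrite yE; apply/eqP; rewrite pnatr_eq0 eqb0.
by apply: contra ny => /eqP ->; rewrite addnC mulnC modnMDl.
Qed.

(** Here the second weight is the sharp indicator of the class of [j], of l1 norm at most
    [1 + (2 + 2 ln p)]. *)
Lemma coset_meets_residues (K n i c j : nat) :
  (0 < n < p)%N -> (j < n)%N -> (K <= p)%N ->
  p%:R * (Num.sqrt p%:R * K%:R * (3 + 2 * ln p%:R)) <
   #|H|%:R * (\sum_(k < K) \sum_(l < K)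
                 (c * (i + n * (k + l)) %% p == j %[mod n]))%:R :> R ->
  exists h (k l : 'I_K), [/\ h \in H, x0 * h = (i + n * (k + l))%:R
     & (c * (i + n * (k + l)) %% p = j %[mod n])%N].
Proof.
move=> hn jn Kp; apply: contra_ltP => none; have /andP[n0 np] := hn.
have nF := natFp_neq0 hn.
pose w (y : 'F_p) : nat := (y == j %[mod n] : nat).
pose a := count_coef fpchar
  (fun z : 'I_((p - j).-1 %/ n).+1 => j%:R + n%:R *+ z).
have wE x : (w x)%:R = \sum_u a u * fpchar (u * x).
  rewrite /w residue_indicator//.
  by rewrite (count_coefE fpcharD norm_fpchar fpchar_nontrivial).
have aB : \sum_u `|a u| <= (3 + 2 * ln p%:R)%:C.
  apply: le_trans (progression_coef_sum fpcharD norm_fpchar _ nF _ _) _.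
  - rewrite card_Fp//; apply: leq_ltn_trans (leq_div _ _) _.
    by rewrite prednK ?leq_subr// subn_gt0 (ltn_trans jn).
  - by move=> u /fpchar_dist[].
  rewrite card_Fp// (_ : 3 + 2 * _ = 1 + (2 + 2 * ln p%:R)); last by ring.
  by rewrite rmorphD rmorph1 lerD2l fpchar_dist_sum.
have avoid h (k l : 'I_K) : h \in H -> x0 * h = (i + n * (k + l))%:R ->
    w (c%:R * (x0 * h)) = 0%N.
  move=> hH E; rewrite E /w -natrM val_Fp_nat//.
  by case: eqP => // ok; case: none; exists h, k, l.
have := @coset_avoiding_real K n i c w a _ hn Kp wE aB avoid.
by rewrite /w; under eq_bigr do under eq_bigr do rewrite val_Fp_nat//.
Qed.

End Cosets.
End PrimeField.

(** The multiplicative group is cyclic, so it has an element of order [d = gcdn m N]; its [d] powers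
    are [m]-th roots of unity because [d] divides [m]. *)
Lemma card_roots_of_unity (T : finFieldType) (m : nat) :
  (gcdn m #|T|.-1 <= #|[set h : T | (h != 0%R) && (h ^+ m == 1%R)]|)%N.
Proof.
set N := #|T|.-1; set H := [set _ | _].
have N_gt0 : (0 < N)%N by rewrite /N -subn1 subn_gt0 finNzRing_gt1.
have /hasP[g _ gP] : has N.-primitive_root (enum [pred x : T | x != 0]).
  apply: has_prim_root => //.
  - apply/allP => x; rewrite mem_enum inE => x0; rewrite unity_rootE.
    apply/eqP; apply: (mulfI x0); rewrite mulr1 -exprS prednK ?expf_card//.
    by apply/card_gt0P; exists 0.
  - exact: enum_uniq.
  by rewrite -cardE cardC1.
set d := gcdn m N.
have d_N : (d %| N)%N by exact: dvdn_gcdr.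
have d0 : (0 < d)%N by rewrite gcdn_gt0 N_gt0 orbT.
have dP := dvdn_prim_root gP d_N; set z := g ^+ _ in dP.
have z0 : z != 0.
  apply/eqP => zE; have := prim_expr_order dP.
  by rewrite zE expr0n (gtn_eqF d0) => /eqP; rewrite eq_sym oner_eq0.
have inj : injective (fun t : 'I_d => z ^+ t).
  move=> t u /eqP; rewrite (eq_prim_root_expr dP) !modn_small ?ltn_ord//.
  by move/eqP/val_inj.
rewrite -[leqLHS]card_ord -(card_codom inj); apply: subset_leq_card.
apply/fintype.subsetP => _ /codomP[t ->]; rewrite inE expf_neq0//=.
rewrite -exprM mulnC exprM (_ : z ^+ m = 1) ?expr1n//.
by apply/eqP; rewrite -(prim_order_dvd dP) dvdn_gcdl.
Qed.

(** * Coset points satisfying both congruences *)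

Section Hits.
Variables (p n c i j m : nat) (x0 : 'F_p).
Hypotheses (p_prime : prime p) (n_ge2 : (2 <= n)%N) (n_le_c : (n <= c)%N).
Hypotheses (cn_le_p : (c * n <= p)%N) (i_lt : (i < n)%N) (j_lt : (j < n)%N).
Hypothesis x0_neq0 : x0 != 0.

(** For [m = k - 1] the power equation places [x] in the coset of [x0], where the map is
    multiplication by [C]; [c] is [|C|]. *)
Definition hit (x : nat) : Prop :=
  [/\ (0 < x < p)%N, x%:R ^+ m = x0 ^+ m, (x = i %[mod n])%N
    & (c * x %% p = j %[mod n])%N].

Let n_gt0 : (0 < n)%N := ltnW n_ge2.
Let c_gt0 : (0 < c)%N := leq_trans n_gt0 n_le_c.
Let p_gt0 : (0 < p)%N := prime_gt0 p_prime.

Let cn_gt0 : (0 < c * n)%N. Proof. by rewrite muln_gt0 c_gt0. Qed.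

Let cn_lt_p : (c * n < p)%N.
Proof.
(* Equality would factor the prime [p] into [c] and [n], both at least 2. *)
rewrite ltn_neqAle cn_le_p andbT; apply/eqP => cnp.
have : (n %| p)%N by rewrite -cnp dvdn_mull.
rewrite dvdn_prime2// => [/eqP np|]; first by move: cnp; rewrite np; nia.
have [q q1 q2] := pdivP n_ge2.
have : (q %| p)%N by apply: dvdn_trans q2 _; rewrite -cnp dvdn_mull.
rewrite dvdn_prime2// => /eqP qp; move: (dvdn_leq n_gt0 q2).
by rewrite qp -cnp; nia.
Qed.

Let n_lt_p : (n < p)%N. Proof. by nia. Qed.

Let pn_coprime : coprime p n.
Proof. by rewrite prime_coprime// gtnNdvd. Qed.

Let s_gt0 : (0 < p %/ (c * n))%N. Proof. by rewrite divn_gt0. Qed.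

Let s_large : (p < 2 * (p %/ (c * n)) * (c * n))%N.
Proof.
apply: (@leq_trans ((p %/ (c * n)).+1 * (c * n))%N); first exact: ltn_ceil.
by rewrite leq_mul2r; apply/orP; right; lia.
Qed.

Lemma hit_all_residues : m = 0%N -> exists x, hit x.
Proof.
move=> m0; have [xs xsi xsP] :=
  @progression_in_residues p n c i j n_gt0 n_le_c cn_le_p pn_coprime i_lt.
have [ltp good] := xsP 0%N s_gt0; rewrite muln0 addn0 in ltp good.
(* The run may start at 0, outside the range. Then [i] and [j] are 0 modulo [n], and [x = n] works
   because [c * n < p]. *)
have [xs0|xs0] := posnP xs; last by exists xs; split; rewrite ?xs0 ?ltp// m0.
exists n; split; rewrite ?n_gt0 ?n_lt_p ?m0//.
  by rewrite modnn -xsi xs0 mod0n.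
by rewrite (modn_small cn_lt_p) modnMl -good xs0 muln0 !mod0n.
Qed.

Let H := [set h : 'F_p | (h != 0) && (h ^+ m == 1)].

Let H_neq0 h : h \in H -> h != 0.
Proof. by rewrite inE => /andP[]. Qed.

Let H_mul g h : g \in H -> h \in H -> g * h \in H.
Proof.
rewrite !inE => /andP[g0 /eqP g1] /andP[h0 /eqP h1].
by rewrite mulf_neq0//= exprMn g1 h1 mulr1.
Qed.

Let hit_of_coset h x : h \in H -> x0 * h = x%:R -> (x < p)%N ->
  x = i %[mod n] -> (c * x %% p = j %[mod n])%N -> hit x.
Proof.
move=> hH E xp xi xj; have := hH; rewrite inE => /andP[h0 /eqP h1].
split=> //; last by rewrite -E exprMn h1 mulr1.
rewrite xp andbT lt0n; apply/eqP => x00; move: E; rewrite x00 => /eqP.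
by rewrite mulf_eq0 (negPf x0_neq0) (negPf h0).
Qed.

Variable R : realType.
Hypothesis p_large : 10 ^+ 6 < p%:R :> R.
Hypothesis d_large : 88 / 100 * n%:R ^+ 2 * Num.sqrt p%:R * ln p%:R ^+ 2
  <= (gcdn m (p - 1))%:R :> R.

Let ln12 : 12 <= ln p%:R :> R. Proof. exact: ln_ge12. Qed.
Let sqrt_gt0 : 0 < Num.sqrt p%:R :> R. Proof. by rewrite sqrtr_gt0 ltr0n. Qed.

Let H_large :
  88 / 100 * n%:R ^+ 2 * Num.sqrt p%:R * ln p%:R ^+ 2 <= #|H|%:R :> R.
Proof.
apply: le_trans d_large _; rewrite ler_nat subn1.
by have := @card_roots_of_unity 'F_p m; rewrite card_Fp.
Qed.

Let hit_small : (c <= 31 * n)%N -> exists x, hit x.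
Proof.
move=> c_le; have [xs xsi xsP] :=
  @progression_in_residues p n c i j n_gt0 n_le_c cn_le_p pn_coprime i_lt.
(* Half the run, rounded up: [k + l <= 2 * K - 2 < s] keeps the kernel inside it. *)
pose s := (p %/ (c * n))%N; pose K := uphalf s.
have KE : (s <= 2 * K <= s.+1)%N.
  rewrite /K; have := odd_double_half s.+1; rewrite uphalfE -mul2n.
  by clear; case: odd => /=; lia.
clearbody K.
have K_le : (K <= p)%N.
  have : (s <= p)%N by exact: leq_div.
  by move: s_gt0; rewrite -/s; clear -KE; lia.
(* [p < 2 s c n <= 4 K c n], and [124 = 4 * 31]. *)
have big : (p < 124 * (n * n) * K)%N.
  have : (p < 4 * K * (c * n))%N.
    apply: leq_trans s_large _; rewrite -/s leq_mul2r; apply/orP; right.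
    by clear -KE; lia.
  have : (4 * K * (c * n) <= 4 * K * (31 * n * n))%N.
    by rewrite leq_mul2l leq_mul2r c_le !orbT.
  by clear; lia.
have := @coset_meets_progression R p p_prime H x0 H_neq0 H_mul x0_neq0 K n xs.
case=> //; first by rewrite n_gt0.
  have bigR : p%:R < 124 * n%:R ^+ 2 * K%:R :> R.
    by rewrite expr2 -!natrM ltr_nat.
  apply: lt_le_trans (ler_wpM2r (ler0n _ _) H_large).
  have K0 : 0 <= n%:R ^+ 2 * K%:R :> R by rewrite mulr_ge0 ?exprn_ge0 ?ler0n.
  rewrite -[ltRHS](_ : (88 / 100 * (n%:R ^+ 2 * K%:R) * ln p%:R ^+ 2)
      * Num.sqrt p%:R = _).
    rewrite ltr_pM2r//; apply: lt_le_trans bigR _; rewrite -mulrA.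
    (* [0.88 * 144 = 126.72] exceeds 124. *)
    have : 144 <= ln p%:R ^+ 2 :> R by have := ln12; nra.
    by move: K0; set t := n%:R ^+ 2 * _; set u := ln _ ^+ 2; nra.
  by ring.
move=> h [k [l [hH E]]].
have kl : (k + l < s)%N.
  by have := ltn_ord k; have := ltn_ord l; clear -KE; lia.
have [ltp good] := xsP _ kl.
exists (xs + n * (k + l))%N; apply: hit_of_coset hH E _ _ _ => //.
by rewrite addnC mulnC modnMDl.
Qed.

Let hit_big : (31 * n < c)%N -> exists x, hit x.
Proof.
move=> c_gt; pose s := (p %/ (c * n))%N.
(* Largest [K] with [2 * n * (K - 1) <= p - n], so that every [i + n * (k + l)] is below [p]. *)
pose K := ((p - n) %/ (2 * n)).+1.
have K1 : (2 * n * K.-1 <= p - n)%N by rewrite mulnC; exact: leq_trunc_div.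
have K2 : (p - n < 2 * n * K)%N.
  by rewrite mulnC; apply: ltn_ceil; rewrite muln_gt0.
have K_le : (K <= p)%N.
  rewrite /K; apply: leq_ltn_trans (leq_div _ _) _.
  by clear -n_gt0 n_lt_p; lia.
(* The largest [r] allowed in [window_count]. *)
pose q := ((c * n * K - p) %/ (n * p))%N.
have np0 : (0 < n * p)%N by rewrite muln_gt0 n_gt0.
have cnK : (p <= c * n * K)%N.
  have : (62 * (n * K) <= c * (n * K))%N.
    by rewrite leq_mul2r; apply/orP; right; clear -c_gt n_ge2; lia.
  have : (31 * n <= p)%N.
    by apply: leq_trans (leq_trans (ltnW c_gt) _) cn_le_p; rewrite leq_pmulr.
  by move: K2; rewrite -!mulnA; move: (n * K)%N => t; clear; lia.
have q1 : ((n * q).+1 * p <= c * n * K)%N.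
  have := leq_trunc_div (c * n * K - p) (n * p); rewrite -/q.
  by rewrite mulSn [(n * q)%N]mulnC -mulnA; clear -cnK; lia.
have q2 : (c * n * K < q.+1 * (n * p) + p)%N.
  by have := @ltn_ceil (c * n * K - p) _ np0; rewrite -/q; clear; lia.
(* For each fixed [k], the sum over [l] is a window starting at [i + n * k]. *)
have Mge : (K * (q * s) <= \sum_(k < K) \sum_(l < K)
                 (c * (i + n * (k + l)) %% p == j %[mod n]))%N.
  rewrite -[K in (K * _)%N]card_ord -sum_nat_const; apply: leq_sum => k _.
  have ek : (i + n * k = i %[mod n])%N by rewrite addnC mulnC modnMDl.
  apply: leq_trans (window_count j n_gt0 n_le_c cn_le_p pn_coprime ek q1) _.
  rewrite -sum1dep_card big_mkcond /=; apply: leq_sum => l _.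
  by rewrite (mulnDr n) addnA; case: eqP.
have := @coset_meets_residues R p p_prime H x0 H_neq0 H_mul x0_neq0 K n i c j.
case=> //; first by rewrite n_gt0.
  have K0 : 0 < K%:R :> R by rewrite ltr0n.
  apply: (@lt_le_trans _ _ (#|H|%:R * (K%:R * (q%:R * s%:R)))); last first.
    by rewrite ler_wpM2l// -!natrM ler_nat.
  have qs0 : 0 <= K%:R * (q%:R * s%:R) :> R by rewrite !mulr_ge0 ?ler0n.
  apply: lt_le_trans (ler_wpM2r qs0 H_large).
  have n2 : 2 <= n%:R :> R by rewrite ler_nat.
  have cR : 31 * n%:R <= c%:R :> R by rewrite -natrM ler_nat ltnW.
  have cnR : c%:R * n%:R <= p%:R :> R by rewrite -natrM ler_nat.
  have p0 : 0 < p%:R :> R by rewrite ltr0n.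
  have c0 : 0 < c%:R :> R by rewrite ltr0n.
  have q0 : 0 <= q%:R :> R by [].
  have K2R : p%:R <= 2 * n%:R * K%:R + n%:R :> R.
    by rewrite -!natrM -natrD ler_nat addnC -leq_subLR ltnW.
  have q2R : c%:R * n%:R * K%:R <= (q%:R + 1) * (n%:R * p%:R) + p%:R :> R.
    by rewrite natr1 -!natrM -natrD ler_nat ltnW.
  have sR : p%:R < 2 * s%:R * (c%:R * n%:R) :> R.
    by rewrite -!natrM ltr_nat.
  have qR : c%:R <= 2 * (q%:R + 1) * n%:R + 3 :> R.
    rewrite -(ler_pM2r p0).
    have : c%:R * p%:R <= c%:R * (2 * n%:R * K%:R + n%:R) :> R.
      by rewrite ler_pM2l.
    by move: q2R cnR; lra.
  (* The loss [2 n + 3] is at most [7 n / 2], hence at most [7 c / 62] since [c >= 31 n]. *)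
  have qR' : 55 / 62 * c%:R <= 2 * q%:R * n%:R :> R by move: qR n2 cR; lra.
  have qsR : 55 / 62 * p%:R < 4 * (n%:R ^+ 2 * (q%:R * s%:R)) :> R.
    rewrite -(ltr_pM2r c0).
    have : (55 / 62 * c%:R) * p%:R
        < (2 * q%:R * n%:R) * (2 * s%:R * (c%:R * n%:R)) :> R.
      apply: (@le_lt_trans _ _ (2 * q%:R * n%:R * p%:R)).
        by rewrite ler_pM2r.
      rewrite ltr_pM2l//; apply: lt_le_trans qR'; lra.
    by lra.
  have fin : p%:R * (3 + 2 * ln p%:R)
      < 88 / 100 * (n%:R ^+ 2 * (q%:R * s%:R)) * ln p%:R ^+ 2 :> R.
    (* [22 / 100] is [0.88 / 4], the 4 coming from [qsR]. At [ln p = 12] the sides are 27 and about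
       28.1. *)
    have l2 : 3 + 2 * ln p%:R <= 55 / 62 * (22 / 100) * ln p%:R ^+ 2 :> R.
      by have := ln12; nra.
    have l0 : 0 < ln p%:R ^+ 2 :> R by rewrite exprn_gt0//; have := ln12; lra.
    apply: (@le_lt_trans _ _ (p%:R * (55 / 62 * (22 / 100) * ln p%:R ^+ 2))).
      by rewrite ler_pM2l.
    rewrite [ltLHS]mulrA ltr_pM2r//.
    by move: qsR; move: (n%:R ^+ 2 * _) => t; lra.
  have rK : 0 < Num.sqrt p%:R * K%:R :> R by rewrite mulr_gt0.
  rewrite -(ltr_pM2r rK) in fin.
  apply: le_lt_trans (lt_le_trans fin _);
    by rewrite le_eqVlt; apply/orP; left; apply/eqP; ring.
move=> h [k [l [hH E good]]].
exists (i + n * (k + l))%N; apply: hit_of_coset hH E _ _ good => //.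
  have : (n * (k + l) <= 2 * n * K.-1)%N.
    rewrite [(2 * n)%N]mulnC -mulnA leq_mul2l; apply/orP; right.
    by have := ltn_ord k; have := ltn_ord l; rewrite /K /=; clear; lia.
  by clear -K1 i_lt n_lt_p; lia.
by rewrite addnC mulnC modnMDl.
Qed.

Lemma hit_coset : exists x, hit x.
Proof. by have [/hit_small|/hit_big] := leqP c (31 * n). Qed.

End Hits.

(** * Integer residues and the sign of [C] *)

Lemma modz_opp_nat (p a : nat) : (0 < p)%N -> (0 < a %% p)%N ->
  ((- a%:Z) %% p%:Z)%Z = (p - a %% p)%N%:Z.
Proof.
move=> p0 a0; have lt_r := ltn_pmod a p0.
have -> : - a%:Z = (- (a %/ p).+1%:Z) * p%:Z + (p - a %% p)%N%:Z.
  by have := divn_eq a p; move: (a %/ p)%N (a %% p)%N a0 lt_r => q r; nia.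
by rewrite modzMDl modz_small//; lia.
Qed.

Lemma residue_map_linear (p k x y : nat) (A C : int) : prime p ->
  (0 < k)%N -> (x%:R : 'F_p) ^+ (k - 1) = y%:R ^+ (k - 1) ->
  (C = A * y%:Z ^+ (k - 1) %[mod p%:Z])%Z ->
  residue_map p k A x%:Z = ((C * x%:Z) %% p%:Z)%Z.
Proof.
move=> p_prime k0 xy CE; rewrite /residue_map -[in RHS]modzMml CE modzMml.
have xyE : (x ^ (k - 1) = y ^ (k - 1) %[mod p])%N.
  by rewrite -!val_Fp_nat// !natrX xy.
have -> : x%:Z ^+ k = x%:Z ^+ (k - 1) * x%:Z by rewrite -exprSr subn1 prednK.
rewrite mulrA -modzMml -[in RHS]modzMml; congr (_ * _ %% _)%Z.
rewrite -modzMmr -[in RHS]modzMmr; congr (_ * _ %% _)%Z.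
by rewrite -!natz -!natrX !natz !modz_nat xyE.
Qed.

Local Open Scope classical_set_scope.

Theorem theorem3p1 (R : realType) (p n k : nat) (A : int)
  (p_prime : prime p) (p_odd : odd p) (n_ge2 : (2 <= n)%N)
  (A_small : `|A|%:Q < p%:Q / 2) (A_ndvd : ~~ (p%:Z %| A)%Z)
  (k_bounds : (1 <= k < p - 1)%N) (k_coprime : gcdn k (p - 1) = 1%N)
  (hC : exists C : int,
      coef_set p k A C /\ n%:Q <= `|C|%:Q <= p%:Q / n%:Q)
  (hd : (10 ^+ 6 < p%:R :> R /\
         88 / 100 * n%:R ^+ 2 * Num.sqrt p%:R * ln p%:R ^+ 2
           <= (gcdn (k - 1) (p - 1))%:R :> R)
        \/ k = 1%N) :
  forall i j : nat, (i < n)%N -> (j < n)%N ->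
    (residue_map p k A @` residue_class p n i) `&` residue_class p n j !=set0.
Proof.
move=> i j i_n j_n; have p0 := prime_gt0 p_prime; have n0 := ltnW n_ge2.
have [C [[_ [y0 [y0_bnd CE]]] /andP[nC Cp]]] := hC.
have [y yE] : exists y : nat, y0 = y%:Z.
  by case: y0 y0_bnd {CE} => [y|y] /andP[h _]; [exists y | lia].
have y_bnd : (0 < y < p)%N by move: y0_bnd; rewrite yE; lia.
have yF := natFp_neq0 p_prime y_bnd.
pose c := `|C|%N.
have n_c : (n <= c)%N by move: nC; rewrite ler_int /c; clear; lia.
have cn_p : (c * n <= p)%N.
  move: Cp; rewrite ler_pdivlMr ?ltr0z// -intrM ler_int /c.
  by rewrite -abszE -PoszM.
have c0 : (0 < c)%N := leq_trans n0 n_c.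
have k0 : (0 < k)%N by case/andP: k_bounds.
have hits j' : (j' < n)%N -> exists x, hit n c i j' (k - 1) (y%:R : 'F_p) x.
  move=> j'_n; case: hd => [[p_large d_large]|k1].
    exact: (@hit_coset _ _ _ _ _ _ _ p_prime n_ge2 n_c cn_p i_n j'_n yF R).
  by apply: hit_all_residues => //; rewrite k1.
(* For negative [C] the residue of [C x] is [p - (c * x %% p)], so [c * x %% p] must lie in the
   class of [p - j]; [j * n.-1] again encodes [-j]. *)
pose j' := (if (0 <= C)%R then j else (p + j * n.-1) %% n)%N.
have [|x [/andP[x0 xp] xy xi xj]] := hits j'.
  by rewrite /j'; case: ifP => // _; exact: ltn_pmod.
(* [p] divides neither [x] nor [c], as [c < c * n <= p]; so the residue and its complement both lie
   in [1..p-1]. *)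
have r0 : (0 < c * x %% p)%N.
  rewrite lt0n -/(dvdn p (c * x)) Euclid_dvdM// negb_or !gtnNdvd//.
  by apply: leq_trans cn_p; rewrite ltn_Pmulr.
have rp : (c * x %% p < p)%N by exact: ltn_pmod.
rewrite yE in CE; have fE := residue_map_linear p_prime k0 xy CE.
exists (residue_map p k A x%:Z); split.
  exists x%:Z => //; split; first by clear -x0 xp; lia.
  by rewrite !modz_nat xi.
rewrite fE.
have [C0|C0] := leP 0 C.
  have -> : C = c%:Z by rewrite /c gez0_abs.
  rewrite -PoszM modz_nat; split.
    by clear -r0 rp; move: (_ %% _)%N r0 rp => r; lia.
  by rewrite !modz_nat xj /j' C0.
have -> : C * x%:Z = - (c * x)%N%:Z by rewrite PoszM /c ltz0_abs// mulNr opprK.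
rewrite modz_opp_nat//; split.
  by clear -r0 rp; move: (_ %% _)%N r0 rp => r; lia.
rewrite !modz_nat; congr Posz; apply/eqP; rewrite -(eqn_modDl (c * x %% p)).
rewrite subnKC ?(ltnW rp)// -[in X in _ == X]modnDml xj /j' leNgt C0 /=.
by rewrite modn_mod modnDml -addnA -mulnSr prednK// [(p + _)%N]addnC modnMDl.
Qed.
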